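(* Each Gr-category is Gr-equivalent to a strict Gr-category.
   Context: A Gr-category is a monoidal category in which every object is invertible (up to isomorphism, with respect to $\otimes$) and every morphism is an isomorphism. It is strict if the associativity constraint and the left and right unit constraints are all identities. Two Gr-categories are Gr-equivalent if there is a monoidal equivalence between them, i.e. a monoidal functor whose underlying functor is an equivalence of categories. *)

(* Defs.v *)
Set Implicit Arguments.
Unset Strict Implicit.
Unset Printing Implicit Defensive.

Declare Scope cat_scope.
Delimit Scope cat_scope with cat.
Local Open Scope cat_scope.

Record Category : Type := {
  Obj :> Type;
  Hom : Obj -> Obj -> Type;
  idm : forall x : Obj, Hom x x;
  comp : forall x y z : Obj, Hom y z -> Hom x y -> Hom x z;
  comp_idl : forall (x y : Obj) (f : Hom x y), comp (idm y) f = f;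
  comp_idr : forall (x y : Obj) (f : Hom x y), comp f (idm x) = f;
  comp_assoc : forall (x y z w : Obj) (h : Hom z w) (g : Hom y z) (f : Hom x y),
    comp h (comp g f) = comp (comp h g) f
}.

Arguments Hom {c} x y.
Arguments idm {c} x.
Arguments comp {c x y z} g f.

Notation "g '\oc' f" := (comp g f) (at level 40, left associativity) : cat_scope.

Definition is_iso (C : Category) (x y : C) (f : Hom x y) : Prop :=
  exists g : Hom y x, g \oc f = idm x /\ f \oc g = idm y.

Definition isomorphic (C : Category) (x y : C) : Prop :=
  exists f : Hom x y, is_iso f.

(* [is_identity f] says that source and target of [f] are the same object and
   that [f] is the identity of this object. An inductive family is used because
   the source and target of [f] need not be convertible. *)
Inductive is_identity (C : Category) : forall x y : C, Hom x y -> Prop :=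
| Is_identity : forall x : C, is_identity (idm x).

Record Functor (C D : Category) : Type := {
  fobj :> C -> D;
  fmap : forall x y : C, Hom x y -> Hom (fobj x) (fobj y);
  fmap_id : forall x : C, fmap (idm x) = idm (fobj x);
  fmap_comp : forall (x y z : C) (g : Hom y z) (f : Hom x y),
    fmap (g \oc f) = fmap g \oc fmap f
}.

Arguments fmap {C D} _ {x y} _.

Definition id_functor (C : Category) : Functor C C :=
  {| fobj := fun x => x;
     fmap := fun x y f => f;
     fmap_id := fun x => eq_refl;
     fmap_comp := fun x y z g f => eq_refl |}.

Lemma comp_fmap_id (C D E : Category) (G : Functor D E) (F : Functor C D)
  (x : C) : fmap G (fmap F (idm x)) = idm (G (F x)).
Proof. rewrite fmap_id; apply fmap_id. Qed.

Lemma comp_fmap_comp (C D E : Category) (G : Functor D E) (F : Functor C D)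
  (x y z : C) (g : Hom y z) (f : Hom x y) :
  fmap G (fmap F (g \oc f)) = fmap G (fmap F g) \oc fmap G (fmap F f).
Proof. rewrite fmap_comp; apply fmap_comp. Qed.

Definition comp_functor (C D E : Category) (G : Functor D E) (F : Functor C D) :
  Functor C E :=
  {| fobj := fun x => G (F x);
     fmap := fun x y f => fmap G (fmap F f);
     fmap_id := @comp_fmap_id C D E G F;
     fmap_comp := @comp_fmap_comp C D E G F |}.

Definition naturally_isomorphic (C D : Category) (F G : Functor C D) : Prop :=
  exists t : forall x : C, Hom (F x) (G x),
    (forall x : C, is_iso (t x)) /\
    (forall (x y : C) (f : Hom x y), t y \oc fmap F f = fmap G f \oc t x).

Definition is_equivalence (C D : Category) (F : Functor C D) : Prop :=
  exists G : Functor D C,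
    naturally_isomorphic (comp_functor G F) (id_functor C) /\
    naturally_isomorphic (comp_functor F G) (id_functor D).

Record MonoidalCategory : Type := {
  mcat :> Category;
  tensor : mcat -> mcat -> mcat;
  tmap : forall x x' y y' : mcat,
    Hom x x' -> Hom y y' -> Hom (tensor x y) (tensor x' y');
  munit : mcat;
  assoc : forall x y z : mcat,
    Hom (tensor (tensor x y) z) (tensor x (tensor y z));
  lunit : forall x : mcat, Hom (tensor munit x) x;
  runit : forall x : mcat, Hom (tensor x munit) x;

  tmap_id : forall x y : mcat, tmap (idm x) (idm y) = idm (tensor x y);
  tmap_comp : forall (x x' x'' y y' y'' : mcat)
    (f' : Hom x' x'') (f : Hom x x') (g' : Hom y' y'') (g : Hom y y'),
    tmap (f' \oc f) (g' \oc g) = tmap f' g' \oc tmap f g;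

  assoc_iso : forall x y z : mcat, is_iso (assoc x y z);
  assoc_natural : forall (x x' y y' z z' : mcat)
    (f : Hom x x') (g : Hom y y') (h : Hom z z'),
    assoc x' y' z' \oc tmap (tmap f g) h =
    tmap f (tmap g h) \oc assoc x y z;
  lunit_iso : forall x : mcat, is_iso (lunit x);
  lunit_natural : forall (x x' : mcat) (f : Hom x x'),
    lunit x' \oc tmap (idm munit) f = f \oc lunit x;
  runit_iso : forall x : mcat, is_iso (runit x);
  runit_natural : forall (x x' : mcat) (f : Hom x x'),
    runit x' \oc tmap f (idm munit) = f \oc runit x;

  pentagon : forall x y z w : mcat,
    assoc x y (tensor z w) \oc assoc (tensor x y) z w =
    tmap (idm x) (assoc y z w) \oc assoc x (tensor y z) w
      \oc tmap (assoc x y z) (idm w);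
  triangle : forall x y : mcat,
    tmap (idm x) (lunit y) \oc assoc x munit y = tmap (runit x) (idm y)
}.

Arguments tensor {m} x y.
Arguments tmap {m x x' y y'} f g.
Arguments munit {m}.
Arguments assoc {m} x y z.
Arguments lunit {m} x.
Arguments runit {m} x.

Notation "x '\ox' y" := (tensor x y) (at level 35, right associativity) : cat_scope.
Notation "f '\om' g" := (tmap f g) (at level 35, right associativity) : cat_scope.

(* Strong monoidal functors: the structure morphisms are invertible. *)
Record MonoidalFunctor (C D : MonoidalCategory) : Type := {
  mfunctor :> Functor C D;
  mu : forall x y : C, Hom (mfunctor x \ox mfunctor y) (mfunctor (x \ox y));
  eps : Hom (@munit D) (mfunctor (@munit C));

  mu_iso : forall x y : C, is_iso (mu x y);
  mu_natural : forall (x x' y y' : C) (f : Hom x x') (g : Hom y y'),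
    mu x' y' \oc (fmap mfunctor f \om fmap mfunctor g) =
    fmap mfunctor (f \om g) \oc mu x y;
  eps_iso : is_iso eps;

  mu_assoc : forall x y z : C,
    fmap mfunctor (assoc x y z) \oc mu (x \ox y) z
      \oc (mu x y \om idm (mfunctor z)) =
    mu x (y \ox z) \oc (idm (mfunctor x) \om mu y z)
      \oc assoc (mfunctor x) (mfunctor y) (mfunctor z);
  mu_lunit : forall x : C,
    fmap mfunctor (lunit x) \oc mu munit x \oc (eps \om idm (mfunctor x)) =
    lunit (mfunctor x);
  mu_runit : forall x : C,
    fmap mfunctor (runit x) \oc mu x munit \oc (idm (mfunctor x) \om eps) =
    runit (mfunctor x)
}.

Definition invertible_object (C : MonoidalCategory) (x : C) : Prop :=
  exists y : C, isomorphic (x \ox y) munit /\ isomorphic (y \ox x) munit.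

Record GrCategory : Type := {
  gr_mcat :> MonoidalCategory;
  gr_invertible : forall x : gr_mcat, invertible_object x;
  gr_groupoid : forall (x y : gr_mcat) (f : Hom x y), is_iso f
}.

Definition is_strict (C : MonoidalCategory) : Prop :=
  (forall x y z : C, is_identity (assoc x y z)) /\
  (forall x : C, is_identity (lunit x)) /\
  (forall x : C, is_identity (runit x)).

Definition Gr_equivalent (C D : GrCategory) : Prop :=
  exists F : MonoidalFunctor C D, is_equivalence F.

(* Main.v *)
(* The strictification has as objects the words of objects of [C], a word
   [x1 ... xn] standing for [flat = x1 (x) (... (x) (xn (x) 1))], and as
   morphisms from [l] to [m] all the morphisms [flat l -> flat m] of [C].
   Words are multiplied by concatenation, and morphisms are multiplied through
   the canonical isomorphisms [flat l (x) flat m -> flat (l ++ m)]. Kelly's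
   consequences of the pentagon and triangle axioms show that these isomorphisms
   are compatible with the constraints of [C] and the identity constraints
   on words; hence the latter are natural, and sending an object to the
   one-letter word is a monoidal equivalence. *)

From Corelib Require Import ssreflect.
From Stdlib Require Import List ProofIrrelevance IndefiniteDescription.
Require Import Defs.

Set Implicit Arguments.
Unset Strict Implicit.
Unset Printing Implicit Defensive.

Local Open Scope cat_scope.

(** * Isomorphisms and identities *)

Section Isomorphisms.
Variable C : Category.
Implicit Types x y z w : C.

(** [is_iso] only asserts that an inverse exists; indefinite description turns it into a morphism
    usable in later definitions. *)
Definition inv x y (f : Hom x y) (H : is_iso f) : Hom y x :=
  proj1_sig (constructive_indefinite_description _ H).

Lemma inv_comp x y (f : Hom x y) (H : is_iso f) : inv H \oc f = idm x.
Proof. exact: proj1 (proj2_sig (constructive_indefinite_description _ H)). Qed.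

Lemma comp_inv x y (f : Hom x y) (H : is_iso f) : f \oc inv H = idm y.
Proof. exact: proj2 (proj2_sig (constructive_indefinite_description _ H)). Qed.

Lemma inv_compK x y z (f : Hom x y) (H : is_iso f) (g : Hom z x) :
  inv H \oc (f \oc g) = g.
Proof. by rewrite comp_assoc inv_comp comp_idl. Qed.

Lemma comp_invK x y z (f : Hom x y) (H : is_iso f) (g : Hom z y) :
  f \oc (inv H \oc g) = g.
Proof. by rewrite comp_assoc comp_inv comp_idl. Qed.

Lemma inv_iso x y (f : Hom x y) (H : is_iso f) : is_iso (inv H).
Proof. by exists f; split; [exact: comp_inv | exact: inv_comp]. Qed.

Lemma idm_iso x : is_iso (idm x).
Proof. by exists (idm x); split; rewrite comp_idl. Qed.

Lemma comp_iso x y z (g : Hom y z) (f : Hom x y) :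
  is_iso g -> is_iso f -> is_iso (g \oc f).
Proof.
move=> Hg Hf; exists (inv Hf \oc inv Hg); split; rewrite -comp_assoc.
- by rewrite inv_compK inv_comp.
- by rewrite comp_invK comp_inv.
Qed.

Lemma iso_mono x y z (p : Hom y z) (f g : Hom x y) :
  is_iso p -> p \oc f = p \oc g -> f = g.
Proof. by move=> H E; rewrite -(inv_compK H f) E inv_compK. Qed.

Lemma iso_epi x y z (p : Hom x y) (f g : Hom y z) :
  is_iso p -> f \oc p = g \oc p -> f = g.
Proof.
by move=> H E; rewrite -(comp_idr f) -(comp_inv H) comp_assoc E -comp_assoc
  comp_inv comp_idr.
Qed.

(** Lets an equation between binary composites be rewritten at the head of a right-associated
    chain. *)
Lemma comp_eqr x y z w v (f : Hom y z) (g : Hom x y) (f' : Hom w z)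
    (g' : Hom x w) (k : Hom v x) :
  f \oc g = f' \oc g' -> f \oc (g \oc k) = f' \oc (g' \oc k).
Proof. by move=> E; rewrite !comp_assoc E. Qed.

Lemma isomorphic_refl x : isomorphic x x.
Proof. by exists (idm x); exact: idm_iso. Qed.

Lemma isomorphic_trans x y z :
  isomorphic x y -> isomorphic y z -> isomorphic x z.
Proof. by move=> [f Hf] [g Hg]; exists (g \oc f); exact: comp_iso. Qed.

Lemma isomorphic_sym x y : isomorphic x y -> isomorphic y x.
Proof. by move=> [f Hf]; exists (inv Hf); exact: inv_iso. Qed.

(** The identity transported along [e]: words such as [(l ++ m) ++ n] and [l ++ (m ++ n)] are equal
    but not convertible. *)
Definition cast_hom x y (e : x = y) : Hom x y :=
  match e with eq_refl => idm x end.

Lemma cast_hom_is_identity x y (e : x = y) : is_identity (cast_hom e).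
Proof. by destruct e. Qed.

Lemma cast_hom_iso x y (e : x = y) : is_iso (cast_hom e).
Proof. by destruct e; exact: idm_iso. Qed.

Lemma cast_hom_refl x (e : x = x) : cast_hom e = idm x.
Proof. by rewrite (proof_irrelevance _ e eq_refl). Qed.

Lemma is_identity_cast x y (f : Hom x y) :
  is_identity f -> exists e : x = y, f = cast_hom e.
Proof. by case=> z; exists eq_refl. Qed.

(* Parallel casts agree by proof irrelevance: this gives the pentagon and
   triangle of the word category without any computation. *)
Lemma is_identity_unique x y (f g : Hom x y) :
  is_identity f -> is_identity g -> f = g.
Proof.
move=> /is_identity_cast [e ->] /is_identity_cast [e' ->].
by rewrite (proof_irrelevance _ e e').
Qed.

Lemma is_identity_comp x y z (g : Hom y z) (f : Hom x y) :
  is_identity g -> is_identity f -> is_identity (g \oc f).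
Proof.
move=> Hg Hf; destruct Hg; rewrite comp_idl; exact: Hf.
Qed.

End Isomorphisms.

(** * Coherence of the units *)

Section UnitCoherence.
Variable C : MonoidalCategory.
Implicit Types x y z : C.

Lemma tmap_comp_l x x' x'' y (f' : Hom x' x'') (f : Hom x x') :
  (f' \oc f) \om idm y = (f' \om idm y) \oc (f \om idm y).
Proof. by rewrite -tmap_comp comp_idl. Qed.

Lemma tmap_comp_r x y y' y'' (g' : Hom y' y'') (g : Hom y y') :
  idm x \om (g' \oc g) = (idm x \om g') \oc (idm x \om g).
Proof. by rewrite -tmap_comp comp_idl. Qed.

Lemma tmap_iso x x' y y' (f : Hom x x') (g : Hom y y') :
  is_iso f -> is_iso g -> is_iso (f \om g).
Proof.
move=> Hf Hg; exists (inv Hf \om inv Hg).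
by split; rewrite -tmap_comp ?inv_comp ?comp_inv tmap_id.
Qed.

Lemma isomorphic_tensor x x' y y' :
  isomorphic x x' -> isomorphic y y' -> isomorphic (x \ox y) (x' \ox y').
Proof. by move=> [f Hf] [g Hg]; exists (f \om g); exact: tmap_iso. Qed.

(** Tensoring with the unit is naturally isomorphic to the identity functor through [lunit], hence
    faithful. *)
Lemma tmap_munit_l_inj x y (f g : Hom x y) :
  idm munit \om f = idm munit \om g -> f = g.
Proof.
move=> E; apply: (iso_epi (lunit_iso x)).
by rewrite -!lunit_natural E.
Qed.

Lemma tmap_munit_r_inj x y (f g : Hom x y) :
  f \om idm munit = g \om idm munit -> f = g.
Proof.
move=> E; apply: (iso_epi (runit_iso x)).
by rewrite -!runit_natural E.
Qed.

(** Kelly's argument: after tensoring with [munit] on the left, this follows from the pentagon at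
    [munit, munit, x, y] and two triangles. *)
Lemma lunit_tensor x y :
  lunit (x \ox y) \oc assoc munit x y = lunit x \om idm y.
Proof.
apply: tmap_munit_l_inj.
apply: (@iso_epi _ _ _ _
  (assoc munit (munit \ox x) y \oc (assoc munit munit x \om idm y))).
  by apply: comp_iso; [exact: assoc_iso | apply: tmap_iso;
    [exact: assoc_iso | exact: idm_iso]].
rewrite tmap_comp_r -comp_assoc [X in _ \oc X]comp_assoc -pentagon.
rewrite comp_assoc triangle -(tmap_id x y) -assoc_natural.
by rewrite comp_assoc -assoc_natural -comp_assoc -tmap_comp_l triangle.
Qed.

(** Mirror argument: tensor with [munit] on the right and use the pentagon at
    [x, y, munit, munit]. *)
Lemma runit_tensor x y :
  (idm x \om runit y) \oc assoc x y munit = runit (x \ox y).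
Proof.
apply: tmap_munit_r_inj; apply: (iso_mono (assoc_iso x y munit)).
rewrite -(triangle (x \ox y) munit) -(tmap_id x y).
rewrite [RHS]comp_assoc assoc_natural -[RHS]comp_assoc pentagon.
rewrite -[X in _ = _ \oc X]comp_assoc [RHS]comp_assoc -tmap_comp_r triangle.
by rewrite [RHS]comp_assoc -assoc_natural -[RHS]comp_assoc -tmap_comp_l.
Qed.

Lemma lunit_munit : lunit munit = runit munit :> Hom (munit \ox munit) (@munit C).
Proof.
apply: tmap_munit_r_inj; rewrite -lunit_tensor -triangle.
(* Once the common associator is dropped, [lunit (munit \ox munit) = idm munit \om lunit munit]
   remains: naturality of [lunit] at [lunit munit]. *)
congr (_ \oc _); apply: (iso_mono (lunit_iso munit)).
by rewrite lunit_natural.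
Qed.

End UnitCoherence.

(** * Strictification by words of objects *)

Section Strictification.
Variable C : MonoidalCategory.
Implicit Types (x y z : C) (l m n : list C).

Fixpoint flat l : C :=
  match l with
  | nil => munit
  | x :: l' => x \ox flat l'
  end.

Fixpoint flat_app l m : Hom (flat l \ox flat m) (flat (l ++ m)) :=
  match l with
  | nil => lunit (flat m)
  | x :: l' => (idm x \om flat_app l' m) \oc assoc x (flat l') (flat m)
  end.

Lemma flat_app_iso l m : is_iso (flat_app l m).
Proof.
elim: l => [|x l IH] /=; first exact: lunit_iso.
by apply: comp_iso; [apply: tmap_iso; [exact: idm_iso | exact: IH]
  | exact: assoc_iso].
Qed.

Definition word_cat : Category :=
  {| Obj := list C;
     Hom := fun l m => Hom (flat l) (flat m);
     idm := fun l => idm (flat l);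
     comp := fun l m n g f => g \oc f;
     comp_idl := fun l m f => comp_idl f;
     comp_idr := fun l m f => comp_idr f;
     comp_assoc := fun l m n p h g f => comp_assoc h g f |}.

Definition word_cast l m (e : l = m) : Hom (flat l) (flat m) :=
  @cast_hom word_cat l m e.

(** Lets the inductions on words peel one letter off a cast; by proof irrelevance any proof of the
    tail equality will do. *)
Lemma word_cast_cons x l m (e : l = m) (e' : x :: l = x :: m) :
  word_cast e' = idm x \om word_cast e.
Proof.
destruct e; rewrite (proof_irrelevance _ e' eq_refl) /=.
by rewrite tmap_id.
Qed.

(** Induction on [l]: the empty word is [lunit_tensor], and each further letter is absorbed by the
    pentagon. This ties the cast on words to [assoc] in [C]. *)
Lemma flat_app_assoc l m n (e : (l ++ m) ++ n = l ++ (m ++ n)) :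
  word_cast e \oc flat_app (l ++ m) n \oc (flat_app l m \om idm (flat n)) =
  flat_app l (m ++ n) \oc (idm (flat l) \om flat_app m n)
    \oc assoc (flat l) (flat m) (flat n).
Proof.
elim: l e => [|x l IH] /= e.
  rewrite /word_cast (cast_hom_refl (C := word_cat)) /= comp_idl.
  by rewrite lunit_natural -comp_assoc lunit_tensor.
rewrite (word_cast_cons (eq_sym (app_assoc l m n))).
rewrite tmap_comp_l -!comp_assoc (comp_eqr _ (assoc_natural _ _ _)).
rewrite !comp_assoc -!tmap_comp_r IH !tmap_comp_r -!comp_assoc.
congr (_ \oc _); rewrite [X in _ \oc X = _]comp_assoc -pentagon.
by rewrite !comp_assoc -assoc_natural tmap_id.
Qed.

(** The induction starts from [lunit_munit], since [flat_app nil nil] is a left unit, and continues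
    by [runit_tensor]. *)
Lemma flat_app_nil l (e : l ++ nil = l) :
  word_cast e \oc flat_app l nil = runit (flat l).
Proof.
elim: l e => [|x l IH] /= e.
  by rewrite /word_cast (cast_hom_refl (C := word_cat)) /= comp_idl lunit_munit.
rewrite (word_cast_cons (app_nil_r l)) comp_assoc -tmap_comp_r IH.
exact: runit_tensor.
Qed.

(** * Tensor product of words and of their morphisms *)

Definition word_tmap l l' m m' (f : Hom (flat l) (flat l'))
    (g : Hom (flat m) (flat m')) : Hom (flat (l ++ m)) (flat (l' ++ m')) :=
  flat_app l' m' \oc (f \om g) \oc inv (flat_app_iso l m).

(** Conjugation in [word_tmap] makes [flat_app] natural by construction; this form keeps inverses
    out of later computations. *)
Lemma word_tmap_flat_app l l' m m' (f : Hom (flat l) (flat l'))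
    (g : Hom (flat m) (flat m')) :
  word_tmap f g \oc flat_app l m = flat_app l' m' \oc (f \om g).
Proof. by rewrite /word_tmap -comp_assoc inv_comp comp_idr. Qed.

Lemma word_tmap_id l m : word_tmap (idm (flat l)) (idm (flat m)) = idm (flat (l ++ m)).
Proof. by rewrite /word_tmap tmap_id comp_idr comp_inv. Qed.

Lemma word_tmap_comp l l' l'' m m' m''
    (f' : Hom (flat l') (flat l'')) (f : Hom (flat l) (flat l'))
    (g' : Hom (flat m') (flat m'')) (g : Hom (flat m) (flat m')) :
  word_tmap (f' \oc f) (g' \oc g) = word_tmap f' g' \oc word_tmap f g.
Proof. by rewrite /word_tmap tmap_comp -!comp_assoc inv_compK. Qed.

Lemma word_tmap_is_identity l l' m m' (f : @Hom word_cat l l')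
    (g : @Hom word_cat m m') :
  is_identity f -> is_identity g ->
  @is_identity word_cat (l ++ m) (l' ++ m') (word_tmap f g).
Proof.
case=> {f}l; case=> {g}m; rewrite /= word_tmap_id.
exact: (@Is_identity word_cat).
Qed.

Definition word_assoc l m n : Hom (flat ((l ++ m) ++ n)) (flat (l ++ (m ++ n))) :=
  word_cast (eq_sym (app_assoc l m n)).

Definition word_runit l : Hom (flat (l ++ nil)) (flat l) :=
  word_cast (app_nil_r l).

(** [f], [g], [h] are arbitrary morphisms of [C], so naturality of the cast is not formal:
    [flat_app_assoc] reduces it to naturality of [assoc]. *)
Lemma word_assoc_natural l l' m m' n n' (f : Hom (flat l) (flat l'))
    (g : Hom (flat m) (flat m')) (h : Hom (flat n) (flat n')) :
  word_assoc l' m' n' \oc word_tmap (word_tmap f g) h =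
  word_tmap f (word_tmap g h) \oc word_assoc l m n.
Proof.
apply: (@iso_epi _ _ _ _ (flat_app (l ++ m) n \oc (flat_app l m \om idm (flat n)))).
  by apply: comp_iso; [exact: flat_app_iso | apply: tmap_iso;
    [exact: flat_app_iso | exact: idm_iso]].
rewrite -[LHS]comp_assoc (comp_eqr _ (word_tmap_flat_app _ _)) -tmap_comp.
rewrite word_tmap_flat_app comp_idr -[h in LHS]comp_idl tmap_comp.
rewrite !comp_assoc flat_app_assoc -[LHS]comp_assoc assoc_natural.
rewrite -[X in _ = X \oc _]comp_assoc -[RHS]comp_assoc flat_app_assoc.
rewrite -[X in _ = _ \oc X]comp_assoc (comp_eqr _ (word_tmap_flat_app _ _)).
rewrite !comp_assoc -[X in X \oc _ = _]comp_assoc -[X in _ = X \oc _]comp_assoc.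
by rewrite -!tmap_comp comp_idl comp_idr word_tmap_flat_app.
Qed.

Lemma word_lunit_natural l l' (f : Hom (flat l) (flat l')) :
  word_tmap (l := nil) (l' := nil) (idm munit) f = f.
Proof.
(* [flat_app nil l] is [lunit (flat l)] by computation. *)
apply: (iso_epi (lunit_iso (flat l))).
by rewrite -(lunit_natural f); exact: (@word_tmap_flat_app nil nil).
Qed.

Lemma word_runit_natural l l' (f : Hom (flat l) (flat l')) :
  word_runit l' \oc word_tmap (m := nil) (m' := nil) f (idm munit) =
  f \oc word_runit l.
Proof.
apply: (iso_epi (flat_app_iso l nil)).
rewrite -[LHS]comp_assoc -[RHS]comp_assoc flat_app_nil -runit_natural.
rewrite -(flat_app_nil (app_nil_r l')) -[RHS]comp_assoc.
by congr (_ \oc _); exact: (@word_tmap_flat_app _ _ nil nil).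
Qed.

(** * The strict monoidal category of words *)

Definition word_mcat : MonoidalCategory.
Proof.
refine {|
  mcat := word_cat;
  tensor := fun l m : word_cat => (l ++ m)%list : word_cat;
  tmap := fun l l' m m' f g => word_tmap f g;
  munit := nil : word_cat;
  assoc := word_assoc;
  (* [nil ++ l] reduces to [l], so a plain identity suffices here; the other two constraints need
     casts. *)
  lunit := fun l => @idm word_cat l;
  runit := word_runit;
  tmap_id := word_tmap_id;
  tmap_comp := fun l l' l'' m m' m'' f' f g' g => word_tmap_comp f' f g' g;
  assoc_iso := fun l m n => @cast_hom_iso word_cat _ _ _;
  assoc_natural := fun l l' m m' n n' f g h => word_assoc_natural f g h;
  lunit_iso := @idm_iso word_cat;
  runit_iso := fun l => @cast_hom_iso word_cat _ _ _;
  runit_natural := fun l l' f => word_runit_natural f |}.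
- by move=> l l' f; rewrite comp_idl comp_idr; exact: word_lunit_natural.
- move=> l m n p; apply: (@is_identity_unique word_cat).
  + by apply: is_identity_comp; exact: cast_hom_is_identity.
  + by do !apply: is_identity_comp; try apply: word_tmap_is_identity;
      first [exact: Is_identity | exact: cast_hom_is_identity].
- move=> l m; apply: (@is_identity_unique word_cat).
  + by apply: is_identity_comp; try apply: word_tmap_is_identity;
      first [exact: Is_identity | exact: cast_hom_is_identity].
  + by apply: word_tmap_is_identity;
      first [exact: Is_identity | exact: cast_hom_is_identity].
Defined.

Lemma word_mcat_strict : is_strict word_mcat.
Proof.
split; first by move=> l m n; exact: cast_hom_is_identity.
by split=> l; [exact: Is_identity | exact: cast_hom_is_identity].
Qed.

(** * Invertibility of words and of their morphisms *)

Lemma isomorphic_word l m :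
  isomorphic (flat l) (flat m) -> @isomorphic word_mcat l m.
Proof. by []. Qed.

Lemma word_mcat_groupoid :
  (forall x y (f : Hom x y), is_iso f) ->
  forall (l m : word_mcat) (f : Hom l m), is_iso f.
Proof. by move=> H l m f; exact: H. Qed.

Lemma isomorphic_flat_app l m : isomorphic (flat (l ++ m)) (flat l \ox flat m).
Proof. by apply: isomorphic_sym; exists (flat_app l m); exact: flat_app_iso. Qed.

Lemma isomorphic_flat_singleton x : isomorphic (flat (x :: nil)) x.
Proof. by exists (runit x); exact: runit_iso. Qed.

Lemma word_mcat_invertible :
  (forall x : C, invertible_object x) ->
  forall l : word_mcat, invertible_object l.
Proof.
move=> H l; have [y [Hr Hl]] := H (flat l).
(* One letter suffices: the inverse in [C] of the whole flattening, rather than a word of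
   inverses. *)
exists (y :: nil : word_mcat); split; apply: isomorphic_word.
- apply: isomorphic_trans (isomorphic_flat_app _ _) _; apply: isomorphic_trans Hr.
  by apply: isomorphic_tensor (isomorphic_refl _) (isomorphic_flat_singleton _).
- apply: isomorphic_trans (isomorphic_flat_app _ _) _; apply: isomorphic_trans Hl.
  by apply: isomorphic_tensor (isomorphic_flat_singleton _) (isomorphic_refl _).
Qed.

(** * The monoidal equivalence given by one-letter words *)

Definition flat_functor : Functor word_cat C :=
  {| fobj := flat : word_cat -> C;
     fmap := fun l m f => f;
     fmap_id := fun l => eq_refl;
     fmap_comp := fun l m n g f => eq_refl |}.

Definition singleton_functor : Functor C word_mcat :=
  {| fobj := fun x => (x :: nil) : word_mcat;
     fmap := fun x y f => f \om idm munit;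
     fmap_id := fun x => tmap_id x munit;
     fmap_comp := fun x y z g f => tmap_comp_l munit g f |}.

Lemma singleton_functor_equivalence : is_equivalence singleton_functor.
Proof.
exists flat_functor; split.
(* [runit] serves in both directions, because a one-letter word on [x] flattens to [x \ox munit]. *)
- exists (fun x => runit x); split=> [x | x y f]; first exact: runit_iso.
  exact: runit_natural.
- exists (fun l => runit (flat l)); split=> [l | l m f].
  + exact: (runit_iso (flat l)).
  + exact: (runit_natural (f : Hom (flat l) (flat m))).
Qed.

(** Undo [flat_app], remove the trailing unit of each letter, then append one unit to the
    product. *)
Definition singleton_mu x y :
    Hom (flat ((x :: nil) ++ (y :: nil))) (flat ((x \ox y) :: nil)) :=
  inv (runit_iso (x \ox y)) \oc (runit x \om runit y)
    \oc inv (flat_app_iso (x :: nil) (y :: nil)).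

Definition singleton_eps : Hom (flat nil) (flat (munit :: nil)) :=
  inv (runit_iso munit).

(** Naturality and coherence of [singleton_mu] are derived from this inverse-free equation. *)
Lemma singleton_muE x y :
  runit (x \ox y) \oc (singleton_mu x y \oc flat_app (x :: nil) (y :: nil)) =
  runit x \om runit y.
Proof. by rewrite /singleton_mu -!comp_assoc comp_invK inv_comp comp_idr. Qed.

Lemma singleton_mu_iso x y : is_iso (singleton_mu x y).
Proof.
apply: comp_iso; last exact: inv_iso.
by apply: comp_iso; [exact: inv_iso | apply: tmap_iso; exact: runit_iso].
Qed.

Lemma singleton_mu_natural x x' y y' (f : Hom x x') (g : Hom y y') :
  singleton_mu x' y' \oc
    word_tmap (l := x :: nil) (l' := x' :: nil) (m := y :: nil) (m' := y' :: nil)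
      (f \om idm munit) (g \om idm munit) =
  ((f \om g) \om idm munit) \oc singleton_mu x y.
Proof.
apply: (iso_mono (runit_iso _)).
apply: (iso_epi (flat_app_iso (x :: nil) (y :: nil))).
rewrite [in RHS]comp_assoc runit_natural -[RHS]comp_assoc -[X in _ = X]comp_assoc.
rewrite singleton_muE -tmap_comp -!runit_natural tmap_comp -singleton_muE.
rewrite -[LHS]comp_assoc -[X in _ \oc X = _]comp_assoc word_tmap_flat_app.
by rewrite -!comp_assoc.
Qed.

(* In the next proofs the structure maps are generalized so that rewriting with
   [comp_assoc] cannot unfold them into composites. *)
Lemma singleton_mu_assoc x y z :
  (assoc x y z \om idm munit) \oc singleton_mu (x \ox y) z \oc
    word_tmap (l := (x :: nil) ++ (y :: nil)) (l' := (x \ox y) :: nil)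
      (m := z :: nil) (m' := z :: nil)      (singleton_mu x y) (idm _) =
  singleton_mu x (y \ox z) \oc
    word_tmap (l := x :: nil) (l' := x :: nil)
      (m := (y :: nil) ++ (z :: nil)) (m' := (y \ox z) :: nil)      (idm _) (singleton_mu y z) \oc
    word_assoc (x :: nil) (y :: nil) (z :: nil).
Proof.
move: singleton_mu singleton_muE => M ME.
set T := word_tmap _ _; set U := word_tmap _ _.
have ET : T \oc _ = _ := word_tmap_flat_app _ _.
have EU : U \oc _ = _ := word_tmap_flat_app _ _.
have EA := flat_app_assoc (eq_sym (app_assoc (x :: nil) (y :: nil) (z :: nil))).
rewrite -/(word_assoc _ _ _) in EA.
move: T U ET EU (word_assoc _ _ _) EA => T U ET EU A EA.
apply: (iso_mono (runit_iso _)).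
apply: (@iso_epi _ _ _ _ (flat_app ((x :: nil) ++ (y :: nil)) (z :: nil)
  \oc (flat_app (x :: nil) (y :: nil) \om idm (flat (z :: nil))))).
  by apply: comp_iso; [exact: flat_app_iso | apply: tmap_iso;
    [exact: flat_app_iso | exact: idm_iso]].
(* Both sides amount to removing the unit after each of the three letters and then reassociating. *)
transitivity (assoc x y z \oc ((runit x \om runit y) \om runit z)).
- rewrite <- !comp_assoc; rewrite (comp_eqr _ (runit_natural _)) (comp_eqr _ ET).
  rewrite -tmap_comp comp_idl.
  rewrite (comp_assoc (M _ _)) (comp_assoc (runit _)) ME.
  by rewrite -tmap_comp ME comp_idr.
- rewrite assoc_natural; rewrite <- !comp_assoc; rewrite [X in U \oc X]comp_assoc EA.
  rewrite <- !comp_assoc; rewrite (comp_eqr _ EU) (comp_assoc (_ \om M y z)).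
  rewrite -tmap_comp comp_idl.
  rewrite (comp_assoc (M _ _)) (comp_assoc (runit _)) ME.
  by rewrite comp_assoc -tmap_comp ME comp_idr.
Qed.

Lemma singleton_mu_lunit x :
  (lunit x \om idm munit) \oc singleton_mu munit x \oc
    word_tmap (l := nil) (l' := munit :: nil) (m := x :: nil) (m' := x :: nil)
      singleton_eps (idm _) = idm (flat (x :: nil)).
Proof.
move: singleton_mu singleton_muE => M ME.
set T := word_tmap _ _.
have ET : T \oc _ = _ := word_tmap_flat_app _ _.
move: T ET => T ET.
apply: (iso_mono (runit_iso _)); apply: (iso_epi (flat_app_iso nil (x :: nil))).
rewrite comp_idr; rewrite <- !comp_assoc; rewrite (comp_eqr _ (runit_natural _)) ET.
rewrite (comp_assoc (M _ _)) (comp_assoc (runit _)) ME.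
(* [singleton_eps] cancels against [runit munit], leaving naturality of [lunit] at [runit x]. *)
by rewrite -tmap_comp comp_inv comp_idr lunit_natural.
Qed.

Lemma singleton_mu_runit x :
  (runit x \om idm munit) \oc singleton_mu x munit \oc
    word_tmap (l := x :: nil) (l' := x :: nil) (m := nil) (m' := munit :: nil)
      (idm _) singleton_eps = word_runit (x :: nil).
Proof.
move: singleton_mu singleton_muE => M ME.
set T := word_tmap _ _.
have ET : T \oc _ = _ := word_tmap_flat_app _ _.
move: T ET => T ET.
apply: (iso_mono (runit_iso _)); apply: (iso_epi (flat_app_iso (x :: nil) nil)).
rewrite -[RHS]comp_assoc flat_app_nil.
rewrite <- !comp_assoc; rewrite (comp_eqr _ (runit_natural _)) ET.
rewrite (comp_assoc (M _ _)) (comp_assoc (runit (x \ox munit))) ME.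
(* The same cancellation leaves naturality of [runit] at [runit x]. *)
by rewrite -tmap_comp comp_inv comp_idr runit_natural.
Qed.

Definition singleton_mfunctor : MonoidalFunctor C word_mcat :=
  {| mfunctor := singleton_functor;
     mu := singleton_mu : forall x y, @Hom word_mcat _ _;
     eps := singleton_eps : @Hom word_mcat _ _;
     mu_iso := singleton_mu_iso;
     mu_natural := fun x x' y y' f g => singleton_mu_natural f g;
     eps_iso := inv_iso (runit_iso munit);
     mu_assoc := singleton_mu_assoc;
     mu_lunit := singleton_mu_lunit;
     mu_runit := singleton_mu_runit |}.

End Strictification.

Definition word_gr (C : GrCategory) : GrCategory :=
  {| gr_mcat := word_mcat C;
     gr_invertible := word_mcat_invertible (@gr_invertible C);
     gr_groupoid := word_mcat_groupoid (@gr_groupoid C) |}.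

Theorem theorem5p3 (C : GrCategory) :
  exists D : GrCategory, is_strict D /\ Gr_equivalent C D.
Proof.
exists (word_gr C); split; first exact: word_mcat_strict.
by exists (singleton_mfunctor C); exact: singleton_functor_equivalence.
Qed.
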